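(* Let $a,b\in\mathbb{R}$ with $b>a>0$. Let $f,g:[a,b]\to\mathbb{R}$ be two absolutely continuous functions such that $f'\in L_\infty[a,b]$ and $g'\in L_1[a,b]$. Then $$\left|\widehat{\mathcal{P}}(f,g)\right|\le\frac12\left(b^2a-\frac{a^3+8b^3}{9}+\frac23 b^3\ln\left(\frac ba\right)\right)\left\|f-\ell f'\right\|_\infty\left\|g-\ell g'\right\|_1,$$ where $\ell(t)=t$ for $t\in[a,b]$.
   Context: For $b>a>0$ and real functions $f,g$ on $[a,b]$, the (Pompeiu–Chebyshev) functional is $$\widehat{\mathcal{P}}(f,g)=\frac{b^3-a^3}{3}\int_a^b f(x)g(x)\,dx-\left(\int_a^b x f(x)\,dx\right)\left(\int_a^b x g(x)\,dx\right).$$ $\|\cdot\|_1$ and $\|\cdot\|_\infty$ are the usual Lebesgue norms on $[a,b]$. *)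

(* Defs.v *)
From HB Require Import structures.
From mathcomp Require Import all_boot all_order all_algebra.
From mathcomp Require Import all_classical all_reals all_analysis.

Set Implicit Arguments.
Unset Strict Implicit.
Unset Printing Implicit Defensive.
Import Order.TTheory GRing.Theory Num.Theory.
Import numFieldNormedType.Exports.

Local Open Scope classical_set_scope.
Local Open Scope ring_scope.

(* A real function on [a, b] is represented by a total function R -> R.  Its
   derivative is the library's total derive1, a two-sided limit that defaults
   to 0 where f is not derivable (a null set in [a, b] for f absolutely
   continuous); only at the end points a and b can it depend on the values of f
   outside [a, b], which does not affect the L_p notions below. *)

Definition abs_continuous (R : realType) (a b : R) (f : R -> R) : Prop :=
  forall e : R, 0 < e -> exists2 d : R, 0 < d &
    forall (n : nat) (s t : 'I_n -> R),
      (forall i, a <= s i /\ s i < t i /\ t i <= b) ->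
      trivIset [set: 'I_n] (fun i => `]s i, t i[%classic) ->
      \sum_(i < n) (t i - s i) < d ->
      \sum_(i < n) `|f (t i) - f (s i)| < e.

(* L_p[a, b]: extension by 0 outside [a, b] preserves both measurability on
   [a, b] and the L_p norm, for p = 1 and p = +oo alike. *)
Definition in_Lp (R : realType) (a b : R) (p : \bar R) (h : R -> R) : Prop :=
  h \_ `[a, b] \in Lfun (@lebesgue_measure R) p.

Definition Lp_norm (R : realType) (a b : R) (p : \bar R) (h : R -> R) : \bar R :=
  ('N[@lebesgue_measure R]_p[EFin \o (h \_ `[a, b])])%E.

Definition pompeiu_chebyshev (R : realType) (a b : R) (f g : R -> R) : R :=
  let mu := @lebesgue_measure R in
  (b ^+ 3 - a ^+ 3) / 3 * (\int[mu]_(x in `[a, b]) (f x * g x))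
  - (\int[mu]_(x in `[a, b]) (x * f x)) * (\int[mu]_(x in `[a, b]) (x * g x)).

(* Main.v *)
Require Import Defs.
From HB Require Import structures.
From mathcomp Require Import all_boot all_order all_algebra.
From mathcomp Require Import all_classical all_reals all_analysis.
From mathcomp Require Import measurable_realfun ess_sup_inf ring lra.
Import Order.TTheory GRing.Theory Num.Theory.
Import numFieldNormedType.Exports.
Local Open Scope classical_set_scope.
Local Open Scope ring_scope.

(** Korkine's identity for the weight [t] reads
    [2 P(f, g) = int int (x f(y) - y f(x)) (x g(y) - y g(x)) dy dx]
    over the square [[a, b] x [a, b]] ([Rintegral_inner]), so it is enough to
    bound the two cross differences. Since
    [x f(y) - y f(x) = x y (f(y) / y - f(x) / x)] and the derivative of
    [f(t) / t] is [- (f(t) - t f'(t)) / t ^ 2], integrating this derivative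
    between [x <= y] gives
    - [|x f(y) - y f(x)| <= M (y - x)], with [M] the sup norm of [f - t f'],
      because [1 / t ^ 2] integrates to [1 / x - 1 / y]
      ([cross_difference_sup_le]);
    - [|x g(y) - y g(x)| <= N y / x], with [N] the L1 norm of [g - t g'],
      because [1 / t ^ 2 <= 1 / x ^ 2] ([cross_difference_L1_le]).
    Hence [2 |P(f, g)|] is at most [M N] times the double integral of
    [|x - y| max(x, y) / min(x, y)], an elementary integral whose value is the
    constant of the theorem ([integral_weight_integral]).

    The analytic content is that [f(t) / t] is the integral of its derivative,
    that is, the fundamental theorem of calculus for absolutely continuous
    functions ([ac_seq_FTC]). An absolutely continuous function has bounded
    variation, and its variation function is absolutely continuous too
    ([ac_seq_variation_to]), so it is a difference of two nondecreasing
    absolutely continuous functions. For a nondecreasing one, the Stieltjes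
    measure is dominated by Lebesgue measure, and the Radon-Nikodym theorem
    provides a density ([nondecreasing_ac_seq_density]); Lebesgue's
    differentiation theorem identifies that density with the derivative. *)

Set Implicit Arguments.
Unset Strict Implicit.
Unset Printing Implicit Defensive.

(** * Absolute continuity and total variation *)

Section ac_families.
Context {R : realType}.
Implicit Types (a b : R) (f g : R -> R) (l : seq (R * R)).

(** Only ordering is tested, not emptiness of set intersections: two of the
    intervals may share an end point, and no order is imposed on the list. *)
Definition disjoint_itvs a b l : bool :=
  all (fun p => [&& a <= p.1, p.1 < p.2 & p.2 <= b]) l &&
  pairwise (fun p q => (p.2 <= q.1) || (q.2 <= p.1)) l.

Definition total_length l : R := \sum_(p <- l) (p.2 - p.1).

(** Absolute continuity quantified over lists of pairs instead of functions on
    an ordinal: lists can be cut and concatenated, which is how partitions of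
    the single intervals are merged below. *)
Definition ac_seq a b f := forall e : R, 0 < e -> exists2 d : R, 0 < d &
  forall l, disjoint_itvs a b l -> total_length l < d ->
  \sum_(p <- l) `|f p.2 - f p.1| < e.

Lemma abs_continuous_ac_seq a b f : abs_continuous a b f -> ac_seq a b f.
Proof.
move=> acf e /acf[d d0 H]; exists d => // l /andP[/all_nthP lab /pairwiseP lP] ld.
pose z : R * R := (0, 0).
have := H (size l) (fun i => (nth z l i).1) (fun i => (nth z l i).2).
rewrite (big_nth z) big_mkord; apply => //; last first.
- by move: ld; rewrite /total_length (big_nth z) big_mkord.
- have aux (i j : 'I_(size l)) x : (i < j)%N ->
    `](nth z l i).1, (nth z l i).2[%classic x ->
    `](nth z l j).1, (nth z l j).2[%classic x -> False.
    move=> ij; have := lP z i j (ltn_ord i) (ltn_ord j) ij.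
    rewrite /= !in_itv/= => /orP[] h /andP[h1 h2] /andP[h3 h4]; lra.
  move=> i j _ _ [x [xi xj]]; apply/val_inj => /=.
  by case: (ltngtP i j) => // ij;
    [case: (aux _ _ _ ij xi xj)|case: (aux _ _ _ ij xj xi)].
- by move=> i; have /and3P[] := lab z i (ltn_ord i).
Qed.

Lemma disjoint_itvs_split a b l1 l2 s x t : s < x -> x < t ->
  disjoint_itvs a b (l1 ++ (s, t) :: l2) ->
  disjoint_itvs a b (rcons l1 (s, x) ++ (x, t) :: l2).
Proof.
move=> sx xt; rewrite /disjoint_itvs -cats1 -!catA/= !all_cat/= !pairwise_cat/=.
rewrite !allrel_consr /=.
move=> /andP[/andP[-> /andP[/and3P[as_ st tb] ->]]].
move=> /andP[/andP[/allP h1 ->]] /andP[-> /andP[/allP h2 ->]].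
rewrite sx xt as_ tb (le_trans as_ (ltW sx)) (le_trans (ltW xt) tb) lexx /= !andbT.
rewrite -andbA; apply/and4P; split; apply/allP => p.
- by move=> /h1/orP[->//|h]; apply/orP; right; lra.
- by move=> /h1/orP[h|->]; rewrite ?orbT//; apply/orP; left; lra.
- by move=> /h2/orP[h|h]; apply/orP; [left|right]; lra.
- by move=> /h2/orP[h|h]; apply/orP; [left|right]; lra.
Qed.

Lemma total_length_split l1 l2 (s x t : R) :
  total_length (rcons l1 (s, x) ++ (x, t) :: l2) =
  total_length (l1 ++ (s, t) :: l2).
Proof.
rewrite /total_length -cats1 !big_cat/= !big_cons big_nil/=; ring.
Qed.

Lemma variation_cons a b f x s :
  variation a b f (x :: s) = `|f x - f a| + variation x b f s.
Proof. by rewrite /variation /= big_nat_recl. Qed.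

(** A family of short total length controls not only the increments of [f] but
    its total variations, since refining each interval by a partition keeps the
    family disjoint and of the same total length. The suprema are taken one
    interval at a time: in the generalized statement [l1] holds the pieces
    already refined and [l] the intervals still to be treated. *)
Lemma total_variation_family_le a b f (e d : R) :
  (forall l, disjoint_itvs a b l -> total_length l < d ->
    \sum_(p <- l) `|f p.2 - f p.1| < e) ->
  forall l, disjoint_itvs a b l -> total_length l < d ->
  (\sum_(p <- l) total_variation p.1 p.2 f <= e%:E)%E.
Proof.
move=> H l.
suff: forall l1, disjoint_itvs a b (l1 ++ l) -> total_length (l1 ++ l) < d ->
    ((\sum_(p <- l1) `|f p.2 - f p.1|)%:E +
     \sum_(p <- l) total_variation p.1 p.2 f <= e%:E)%E.
  by move=> /(_ [::]); rewrite big_nil add0e.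
elim: l => [l1|[s t] l2 IH l1].
  by rewrite cats0 big_nil adde0 lee_fin => h1 h2; apply/ltW/H.
move=> dis len.
have /andP[/allP l2ab _] := dis.
have TVfin : (\sum_(p <- l2) total_variation p.1 p.2 f)%E \is a fin_num.
  rewrite ge0_fin_numE; last first.
    rewrite big_seq sume_ge0// => p pl2; apply: total_variation_ge0.
    have /l2ab/and3P[_ /ltW//] : p \in l1 ++ (s, t) :: l2.
    by rewrite mem_cat inE pl2 !orbT.
  have := IH (l1 ++ [:: (s, t)]); rewrite -catA/= => /(_ dis len).
  move=> h; rewrite ltNge leye_eq; apply/negP => /eqP TVE.
  by move: h; rewrite TVE.
rewrite big_cons/= addeCA -leeBrDr; last first.
  by rewrite fin_numD TVfin.
apply: ub_ereal_sup => _ /= [_ [p pst <-] <-].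
rewrite leeBrDr; last by rewrite fin_numD TVfin.
(* peel off the first piece of the partition and move it to [l1] *)
elim: p s l1 dis len pst l2ab => [|x p IHp] s l1 dis len pst l2ab.
  have /itv_partition_nil st := pst.
  have /l2ab/and3P[_] : (s, t) \in l1 ++ (s, t) :: l2.
    by rewrite mem_cat inE eqxx !orbT.
  by rewrite /= st ltxx.
have [/= /andP[sx xp] /eqP xpt] := pst.
have [p0|p0] := eqVneq p [::].
  move: xpt; rewrite p0/= => xt.
  have := IH (l1 ++ [:: (s, t)]); rewrite -catA/= => /(_ dis len).
  rewrite variation_cons variation_nil addr0 big_cat/= big_seq1/= xt.
  by apply: le_trans; rewrite EFinD addeA (addeC `|_|%:E).
have xt : x < t.
  have := itv_partition_le (itv_partition_cons pst).
  rewrite le_eqVlt => /predU1P[xE|//].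
  by move: (itv_partition_cons pst) p0; rewrite xE => /itv_partitionxx ->.
have := IHp x (rcons l1 (s, x)) (disjoint_itvs_split sx xt dis).
rewrite total_length_split => /(_ len).
have pxt : itv_partition x t p by split => //; apply/eqP.
move=> /(_ pxt); have /andP[/allP dis' _] := disjoint_itvs_split sx xt dis.
move=> /(_ dis'); apply: le_trans.
rewrite variation_cons -cats1 big_cat/= big_seq1/= !EFinD.
by rewrite [(_ + `|_|%:E)%E]addeC -!addeA [leRHS]addeCA.
Qed.

End ac_families.

Section ac_variation.
Context {R : realType}.
Implicit Types (a b : R) (f g : R -> R) (l : seq (R * R)).

Lemma disjoint_itvs1 a b (x y : R) :
  disjoint_itvs a b [:: (x, y)] = [&& a <= x, x < y & y <= b].
Proof. by rewrite /disjoint_itvs /= !andbT. Qed.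

Lemma total_length1 (x y : R) : total_length [:: (x, y)] = y - x.
Proof. by rewrite /total_length big_seq1. Qed.

Lemma ac_seqB a b f g : ac_seq a b f -> ac_seq a b g -> ac_seq a b (f \- g).
Proof.
move=> acf acg e e0; have e20 : 0 < e / 2 by lra.
have [d d0 fd] := acf _ e20; have [d' d'0 gd] := acg _ e20.
exists (Num.min d d'); first by rewrite lt_min d0 d'0.
move=> l lab; rewrite lt_min => /andP[/(fd _ lab) h1 /(gd _ lab) h2].
apply: le_lt_trans (_ : \sum_(p <- l) (`|f p.2 - f p.1| + `|g p.2 - g p.1|) < e).
  apply: ler_sum => p _ /=.
  have -> : f p.2 - g p.2 - (f p.1 - g p.1) = f p.2 - f p.1 - (g p.2 - g p.1) by ring.
  exact: ler_normB.
by rewrite big_split/=; lra.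
Qed.

(** Steps of length [d / 2], with [d] the modulus for increments of sum less
    than 1, reach [b] after finitely many moves, and each of them adds a finite
    amount to the variation. *)
Lemma ac_seq_bounded_variation a b f : a <= b -> ac_seq a b f ->
  bounded_variation a b f.
Proof.
move=> ab acf; have [d d0 fd] := acf _ ltr01.
apply/bounded_variationP => //.
suff H : forall n x, a <= x -> x <= b -> x - a <= n%:R * (d / 2) ->
    total_variation a x f \is a fin_num.
  apply: (H (Num.bound ((b - a) / (d / 2)))) => //.
  rewrite -ler_pdivrMr; last lra.
  by apply/ltW; rewrite (le_lt_trans _ (archi_boundP _)) ?divr_ge0 ?subr_ge0//; lra.
elim=> [|n IH] x ax xb h.
  have -> : x = a by apply/eqP; rewrite eq_le ax andbT; move: h; lra.
  by rewrite total_variationxx.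
have [xad|xad] := leP (x - a) (d / 2).
  move: ax; rewrite le_eqVlt => /predU1P[<-|ax]; first by rewrite total_variationxx.
  rewrite ge0_fin_numE ?total_variation_ge0 ?(ltW ax)//.
  have := @total_variation_family_le _ a b f 1 d fd [:: (a, x)].
  rewrite disjoint_itvs1 total_length1 lexx ax xb big_seq1 => /(_ isT) h1.
  by apply: le_lt_trans (h1 _) _; [lra|rewrite ltry].
have yx : x - d / 2 < x by lra.
rewrite (@total_variationD _ a x (x - d / 2))//; [|lra|lra].
rewrite fin_numD IH/=; [|lra|lra|by move: h; rewrite -natr1; lra].
rewrite ge0_fin_numE ?total_variation_ge0 ?(ltW yx)//.
have := @total_variation_family_le _ a b f 1 d fd [:: (x - d / 2, x)].
rewrite disjoint_itvs1 total_length1 yx xb big_seq1 /= andbT => h1.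
by apply: le_lt_trans (h1 _ _) _; [lra|lra|rewrite ltry].
Qed.

Definition variation_to a f (x : R) : R := fine (total_variation a x f).

Lemma variation_toB a b f s t : bounded_variation a b f ->
  a <= s -> s <= t -> t <= b ->
  (variation_to a f t - variation_to a f s)%:E = total_variation s t f.
Proof.
move=> bv as_ st tb.
have at_ : a <= t by exact: le_trans st.
have sb : s <= b by exact: le_trans tb.
have bvt : total_variation a t f \is a fin_num.
  by apply/bounded_variationP => //; exact: bounded_variationl bv.
have bvs : total_variation a s f \is a fin_num.
  by apply/bounded_variationP => //; exact: bounded_variationl bv.
rewrite /variation_to EFinB !fineK// (total_variationD f as_ st).
by rewrite addeAC subee// add0e.
Qed.

Lemma variation_to_nondecreasing a b f : bounded_variation a b f ->
  {in `[a, b] &, nondecreasing_fun (variation_to a f)}.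
Proof.
move=> bv x y; rewrite !in_itv/= => /andP[ax xb] /andP[ay yb] xy.
rewrite -subr_ge0 -lee_fin (variation_toB bv)//.
exact: total_variation_ge0.
Qed.

Lemma variation_to_sub_nondecreasing a b f : bounded_variation a b f ->
  {in `[a, b] &, nondecreasing_fun (variation_to a f \- f)}.
Proof.
move=> bv x y; rewrite !in_itv/= => /andP[ax xb] /andP[ay yb] xy.
have := total_variation_ge f xy.
rewrite -(variation_toB bv)// lee_fin => h.
have := le_trans (ler_norm _) h; lra.
Qed.

Lemma ac_seq_variation_to a b f : a <= b -> ac_seq a b f ->
  ac_seq a b (variation_to a f).
Proof.
move=> ab acf e e0; have e20 : 0 < e / 2 by lra.
have bv := ac_seq_bounded_variation ab acf.
have [d d0 fd] := acf _ e20; exists d => // l lab ld.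
have /(_ l lab ld) := total_variation_family_le fd.
rewrite (eq_big_seq (fun p => (`|variation_to a f p.2 - variation_to a f p.1|)%:E)).
  by rewrite sumEFin lee_fin => h; lra.
move=> p pl; have /andP[/allP/(_ p pl)/and3P[ap pp pb] _] := lab.
rewrite -(variation_toB bv) ?(ltW pp)// ger0_norm//.
by rewrite -lee_fin (variation_toB bv) ?(ltW pp)// total_variation_ge0// ltW.
Qed.

End ac_variation.

(** * Retraction onto an interval, and traces of open intervals *)

Section clamp.
Context {R : realType}.
Implicit Types (a b x y : R) (f : R -> R).

(** Composing with the retraction of the line onto [[a, b]] turns a function
    that is regular on [[a, b]] only into one that is regular everywhere. *)
Definition clamp a b x : R := Num.max a (Num.min x b).

Lemma clamp_itv a b x : a <= b -> a <= clamp a b x <= b.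
Proof. by move=> ab; rewrite /clamp le_max lexx/= ge_max ab ge_min lexx orbT. Qed.

Lemma clamp_id a b x : a <= x -> x <= b -> clamp a b x = x.
Proof. by move=> ax xb; rewrite /clamp min_l// max_r. Qed.

Lemma clamp_nondecreasing a b : nondecreasing (clamp a b).
Proof.
move=> x y xy; rewrite /clamp ge_max !le_max lexx/= le_min !ge_min xy lexx/=.
by rewrite !orbT.
Qed.

Lemma ler_clampB a b x y : `|clamp a b x - clamp a b y| <= `|x - y|.
Proof.
wlog yx : x y / y <= x => [H|].
  have [yx|/ltW xy] := leP y x; first exact: H.
  by rewrite distrC (distrC x); exact: H.
rewrite ger0_norm ?subr_ge0; last exact: clamp_nondecreasing.
rewrite ger0_norm ?subr_ge0// /clamp !maxEle !minEle.
case: (leP x b) => ?; case: (leP y b) => ?; case: (leP a x) => ?;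
  case: (leP a y) => ?; case: (leP a b) => ?; lra.
Qed.

Lemma ac_seq_unif a b f : ac_seq a b f -> forall e, 0 < e ->
  exists2 d : R, 0 < d & forall x y, a <= x <= b -> a <= y <= b ->
    `|x - y| < d -> `|f x - f y| < e.
Proof.
move=> acf e e0; have [d d0 fd] := acf _ e0; exists d => // x y.
wlog yx : x y / y < x => [H xab yab|/andP[_ xb] /andP[ay _]].
  have [xy|yx|->] := ltgtP x y; [|exact: H|by rewrite !subrr normr0].
  by rewrite distrC (distrC (f x)); exact: H.
rewrite gtr0_norm ?subr_gt0// => xyd.
have := fd [:: (y, x)]; rewrite disjoint_itvs1 total_length1 ay yx xb => /(_ isT xyd).
by rewrite big_seq1.
Qed.

Lemma ac_seq_clamp_continuous a b f : a <= b -> ac_seq a b f ->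
  continuous (f \o clamp a b).
Proof.
move=> ab acf x; apply/cvgrPdist_lt => e e0.
have [d d0 fd] := ac_seq_unif acf e0.
near=> y => /=; apply: fd; rewrite ?clamp_itv//.
apply: le_lt_trans (ler_clampB _ _ _ _) _.
near: y; apply: (@cvgr_dist_lt _ _ _ _ _ id x) => //; exact: cvg_id.
Unshelve. all: by end_near. Qed.

End clamp.

Section interval_hull.
Context {R : realType}.
Implicit Types (J : set R) (x y : R).

Lemma hull_sub_interval J : is_interval J -> has_inf J -> has_sup J ->
  `]inf J, sup J[ `<=` J.
Proof.
move=> iJ [J0 lJ] [_ uJ] x /=; rewrite in_itv/= => /andP[/inf_lt ix /sup_gt xs].
have [y Jy yx] := ix J0; have [z Jz xz] := xs J0.
by apply: (iJ y z) => //; rewrite !ltW.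
Qed.

(** The left end point of [J] is never attained: a point of the open set [I]
    lying in []a, b]] has points of [J] on its left. Hence [J] fits inside a
    half-open interval, of the kind measured exactly by a Stieltjes measure. *)
Lemma open_interval_trace a b (I : set R) : open I -> is_interval I ->
  let J := I `&` `]a, b] in J !=set0 ->
  [/\ a <= inf J, inf J < sup J, sup J <= b,
      `]inf J, sup J[ `<=` J & J `<=` `]inf J, sup J]].
Proof.
move=> oI iI J J0.
have lJ : lbound J a by move=> x [_]/=; rewrite in_itv/= => /andP[/ltW].
have uJ : ubound J b by move=> x [_]/=; rewrite in_itv/= => /andP[].
have hi : has_inf J by split => //; exists a.
have hs : has_sup J by split => //; exists b.
have iJ : is_interval J.
  move=> x y [Ix]/=; rewrite in_itv/= => /andP[ax _] [Iy]/=.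
  rewrite in_itv/= => /andP[_ yb] z /andP[xz zy]; split.
    by apply: (iI x y) => //; rewrite xz.
  by rewrite /= in_itv/= (lt_le_trans ax xz) (le_trans zy yb).
have iN : ~ J (inf J).
  move=> [Ii /=]; rewrite in_itv/= => /andP[ai ib].
  have [e /= e0 eI] := (open_subball oI Ii).
  pose h := Num.min (e / 2) (inf J - a).
  have h0 : 0 < h by rewrite lt_min subr_gt0 ai andbT; lra.
  have he : h <= e / 2 by rewrite ge_min lexx.
  have ha : h <= inf J - a by rewrite ge_min lexx orbT.
  have : J (inf J - h / 2).
    split; last by rewrite /= in_itv/=; apply/andP; split; lra.
    apply: (eI (e / 2)) => /=; [by rewrite /ball_ /= sub0r normrN gtr0_norm; lra|lra|].
    by rewrite /ball/= opprB addrC subrK gtr0_norm; lra.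
  move=> /(ge_inf hi.2); lra.
have JS : J `<=` `]inf J, sup J].
  move=> x Jx; rewrite /= in_itv/= (ub_le_sup _ Jx)//; last by exists b.
  rewrite andbT lt_neqAle (ge_inf hi.2 Jx) andbT.
  by apply/eqP => xE; apply: iN; rewrite xE.
split => //.
- exact: lb_le_inf.
- by have [x /JS/=] := J0; rewrite in_itv/= => /andP[]; exact: lt_le_trans.
- exact: sup_le_ub.
- exact: hull_sub_interval.
Qed.

End interval_hull.

(** * Density of a nondecreasing absolutely continuous function *)

Section stieltjes.
Context {R : realType}.
Variables (a b : R) (G : R -> R).
Hypotheses (ab : a < b) (ndG : {in `[a, b] &, nondecreasing_fun G})
  (acG : ac_seq a b G).

(* the extension of G whose Stieltjes measure charges only [a, b] *)
Let Gc : R -> R := G \o clamp a b.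

Let Gc_nd : nondecreasing Gc.
Proof.
move=> x y xy; apply: ndG; rewrite ?in_itv/= ?clamp_itv ?(ltW ab)//.
exact: clamp_nondecreasing.
Qed.

Let Gc_rc : right_continuous Gc.
Proof. by apply: right_continuousW; apply: ac_seq_clamp_continuous => //; exact: ltW. Qed.

HB.instance Definition _ := isCumulative.Build R _ R Gc Gc_nd Gc_rc.

Local Notation mu := (@lebesgue_measure R).
Local Notation nu := (lebesgue_stieltjes_measure Gc).

Let nu_oc x y : x <= y -> nu `]x, y] = (Gc y - Gc x)%:E.
Proof.
move=> xy; rewrite /lebesgue_stieltjes_measure /measure_extension/=.
rewrite measurable_mu_extE/= ?wlength_itv_bnd//; exact: is_ocitv.
Qed.

Let nu_oc_ab x y : a <= x -> x <= y -> y <= b -> nu `]x, y] = (G y - G x)%:E.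
Proof.
move=> ax xy yb; rewrite nu_oc// /Gc/= !clamp_id//.
  exact: le_trans yb.
exact: le_trans xy.
Qed.

(** An open set is a countable disjoint union of open intervals, so absolute
    continuity, which speaks of finite families, bounds all partial sums. *)
Let nu_open_le e d : (forall l, disjoint_itvs a b l -> total_length l < d ->
    \sum_(p <- l) `|G p.2 - G p.1| < e) ->
  forall U : set R, open U -> (mu U < d%:E)%E -> (nu (U `&` `]a, b]) <= e%:E)%E.
Proof.
move=> H U oU Ud.
pose I := open_disjoint_itv oU; pose J k := I k `&` `]a, b].
have mI k : measurable (I k) by apply: open_measurable; exact: open_disjoint_itv_open.
have mJ k : measurable (J k) by apply: measurableI.
have tI : trivIset setT I := @open_disjoint_itv_trivIset _ _ oU.
have tJ : trivIset setT J by exact: trivIset_setIr.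
have JP k : J k !=set0 -> [/\ a <= inf (J k), inf (J k) < sup (J k), sup (J k) <= b,
      `]inf (J k), sup (J k)[ `<=` J k & J k `<=` `]inf (J k), sup (J k)]].
  move=> J0; apply: open_interval_trace => //.
    exact: open_disjoint_itv_open.
  exact: open_disjoint_itv_is_interval.
rewrite [X in X `&` _](open_disjoint_itv_bigcup oU) setI_bigcupl.
rewrite (_ : nu _ = (\sum_(0 <= i <oo) nu (J i))%E); last first.
  by apply: measure_semi_bigcup; [exact: mJ|exact: tJ|exact: bigcupT_measurable].
apply: lime_le; first by apply: is_cvg_nneseries.
apply: nearW => n.
pose P k := `[< J k !=set0 >].
pose p k := (inf (J k), sup (J k)).
pose l := [seq p k | k <- [seq k <- iota 0 n | P k]].
have bigl (F : R * R -> \bar R) : (\sum_(x <- l) F x = \sum_(0 <= k < n | P k) F (p k))%E.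
  by rewrite /l big_map big_filter /index_iota subn0.
have lab : disjoint_itvs a b l.
  apply/andP; split.
    apply/allP => _ /mapP[k + ->]; rewrite mem_filter => /andP[/asboolP/JP[h1 h2 h3 _ _] _].
    exact/and3P.
  rewrite /l pairwise_map.
  have := filter_all P (iota 0 n).
  have : pairwise ltn [seq k <- iota 0 n | P k].
    by rewrite -sorted_pairwise ?sorted_filter ?iota_ltn_sorted//; exact: ltn_trans.
  move=> + allP; apply: (sub_in_pairwise _ allP) => i j /asboolP/JP[_ ij _ Ji _].
  move=> /asboolP/JP[_ jj _ Jj _] ltij /=; rewrite leNgt; apply/orP.
  have [|h1] := leP (sup (J i)) (inf (J j)); first by left.
  have [|h2] := leP (sup (J j)) (inf (J i)); first by right.
  (* overlapping traces of two members of a disjoint family share a midpoint *)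
  exfalso; pose u := Num.max (inf (J i)) (inf (J j)).
  pose v := Num.min (sup (J i)) (sup (J j)).
  have uv : u < v by rewrite gt_max !lt_min ij h1 h2 jj.
  have ui : inf (J i) <= u by rewrite le_max lexx.
  have uj : inf (J j) <= u by rewrite le_max lexx orbT.
  have vi : v <= sup (J i) by rewrite ge_min lexx.
  have vj : v <= sup (J j) by rewrite ge_min lexx orbT.
  have hi : J i ((u + v) / 2) by apply: Ji; rewrite /= in_itv/=; apply/andP; split; lra.
  have hj : J j ((u + v) / 2) by apply: Jj; rewrite /= in_itv/=; apply/andP; split; lra.
  have ijE : i = j by apply: tJ => //; exists ((u + v) / 2).
  by move: ltij; rewrite ijE /= ltnn.
have ld : total_length l < d.
  rewrite -lte_fin /total_length -sumEFin bigl (le_lt_trans _ Ud)//.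
  apply: (@le_trans _ _ (\sum_(0 <= k < n) mu (I k))%E).
    rewrite [leRHS](bigID P)/=; apply: le_trans (leeDl _ _); last exact: sume_ge0.
    apply: lee_sum => k /asboolP/JP[_ ij _ Jk _].
    rewrite (_ : _%:E = mu `]inf (J k), sup (J k)[); last first.
      by rewrite lebesgue_measure_itv/= lte_fin ij EFinB.
    apply: le_measure; [rewrite inE; exact: measurable_itv|rewrite inE; exact: mI|].
    by move=> x Ix; have [] := Jk _ Ix.
  rewrite [in leRHS](open_disjoint_itv_bigcup oU) (_ : mu _ = (\sum_(0 <= i <oo) mu (I i))%E).
    exact: nneseries_lim_ge.
  by apply: measure_semi_bigcup; [exact: mI|exact: tI|exact: bigcupT_measurable].
have /ltW := H l lab ld; rewrite -lee_fin -sumEFin bigl; apply: le_trans.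
rewrite (bigID P)/= [X in (_ + X)%E]big1 ?adde0; last first.
  move=> k /asboolP/forallNP nJ; rewrite (_ : J k = set0) ?measure0//.
  by rewrite -subset0 => x /nJ.
apply: lee_sum => k /asboolP/JP[aJ /ltW ij Jb _ Jk].
rewrite ger0_norm ?subr_ge0; last first.
  by apply: ndG; rewrite ?in_itv/= ?aJ ?Jb ?(le_trans ij Jb) ?(le_trans aJ ij).
rewrite -nu_oc_ab//.
by apply: le_measure; [rewrite inE; exact: mJ|rewrite inE; exact: measurable_itv|].
Qed.

(** The Stieltjes measure of [G] vanishes on Lebesgue null sets, because a null
    set is covered by an open set of small length; its Radon-Nikodym density is
    [h]. The measure is restricted to []a, b]] to make it finite. *)
Lemma nondecreasing_ac_seq_density : exists h : R -> R,
  mu.-integrable setT (EFin \o h) /\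
  forall x, a <= x <= b -> G x - G a = \int[mu]_(t in `[a, x]) h t.
Proof.
have mab : measurable (`]a, b]%classic : set (measurableTypeR R)) by exact: measurable_itv.
have nuab : (nu `]a, b] < +oo)%E by rewrite nu_oc_ab ?(ltW ab)// ltry.
pose rnu : {finite_measure set (measurableTypeR R) -> \bar R} := mfrestr mab nuab.
have numu : rnu `<< mu.
  apply/null_content_dominatesP => A mA A0.
  apply/eqP; rewrite eq_le measure_ge0 andbT.
  apply/lee_addgt0Pr => e e0; rewrite add0e.
  have [d d0 H] := acG e0.
  have [|U [oU AU Ud]] := lebesgue_regularity_outer mA _ d0.
    by rewrite A0.
  have mU : measurable U := open_measurable oU.
  apply: le_trans (nu_open_le H oU _).
    by apply: le_measure => //; rewrite inE.
  apply: (@le_lt_trans _ _ (mu A + mu (U `\` A))%E); last by rewrite A0 add0e.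
  rewrite -[in leLHS](setDUK AU); apply: measureU2 => //; exact: measurableD.
have [h [h0 hfin hint hE]] := radon_nikodym_sigma_finite numu.
have hEE : EFin \o (fine \o h) = h by apply/funext => x /=; rewrite fineK.
exists (fine \o h); rewrite hEE; split => // x /andP[ax xb].
rewrite -[LHS]/(fine (G x - G a)%:E) -nu_oc_ab//.
have -> : nu `]a, x] = rnu `]a, x]%classic.
  rewrite /rnu /mfrestr /mrestr; congr nu.
  by rewrite setIidl//; apply: subset_itvl; rewrite bnd_simp.
rewrite hE// /Rintegral; congr fine.
rewrite integral_itv_obnd_cbnd; last first.
  by have /integrableP[mh _] := hint; exact: measurable_funTS.
by apply: eq_integral => y _ /=; rewrite fineK.
Qed.

End stieltjes.

(** * The fundamental theorem of calculus for absolutely continuous functions *)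

Section ac_FTC.
Context {R : realType}.
Local Notation mu := (@lebesgue_measure R).

(** Both the variation function [V] of [f] and [V - f] are nondecreasing and
    absolutely continuous, so [f] is an indefinite integral, and Lebesgue's
    differentiation theorem recovers the integrand as the derivative. *)
Lemma ac_seq_FTC (a b : R) (f : R -> R) : a < b -> ac_seq a b f ->
  exists h : R -> R, [/\ mu.-integrable setT (EFin \o h),
    forall x y, a <= x -> x <= y -> y <= b ->
      f y - f x = \int[mu]_(t in `[x, y]) h t &
    {ae mu, forall x, a < x < b -> derivable f x 1 /\ f^`()%classic x = h x}].
Proof.
move=> ab acf; have bv := ac_seq_bounded_variation (ltW ab) acf.
have acV := ac_seq_variation_to (ltW ab) acf.
have [h1 [ih1 h1E]] := nondecreasing_ac_seq_density ab
  (variation_to_nondecreasing bv) acV.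
have [h2 [ih2 h2E]] := nondecreasing_ac_seq_density ab
  (variation_to_sub_nondecreasing bv) (ac_seqB acV acf).
pose h := h1 \- h2.
have ih : mu.-integrable setT (EFin \o h).
  rewrite (_ : EFin \o h = (EFin \o h1) \- (EFin \o h2))%E; last first.
    by apply/funext => x /=; rewrite EFinB.
  exact: integrableB.
have ihS (A : set R) : measurable A -> mu.-integrable A (EFin \o h).
  by move=> mA; exact: integrableS ih.
have hE x : a <= x <= b -> f x = f a + \int[mu]_(t in `[a, x]) h t.
  move=> axb; rewrite RintegralB//; [|exact: integrableS ih1|exact: integrableS ih2].
  by rewrite -h1E// -h2E//=; ring.
exists h; split => //.
- move=> x y ax xy yb.
  have ay := le_trans ax xy; have xb := le_trans xy yb.
  rewrite (hE y) ?ay// (hE x) ?ax//.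
  rewrite -[RHS]Rintegral_itv_obnd_cbnd; last exact: ihS.
  rewrite -(@Rintegral_itvB _ h (BLeft a) (BRight y) x)//; last exact: ihS.
  ring.
- have := lebesgue_differentiation (open_integrable_locally openT ih).
  apply: filterS; first exact: (ae_filter_ringOfSetsType mu).
  move=> x hx /andP[ax xb].
  have [dH H'] := @FTC1_lebesgue_pt _ h (BLeft a) x b xb (ihS _ (measurable_itv _)) ax hx.
  set H := (X in derivable X _ _) in dH H'.
  have fH : {near x, cst (f a) \+ H =1 f}.
    near=> y; rewrite /= /H -hE//; apply/andP; split; apply/ltW; near: y.
      exact: lt_nbhsr.
    exact: lt_nbhsl.
  have dfaH : is_derive x 1 (cst (f a) \+ H) (h x).
    have dH' : is_derive x 1 H (h x).
      by apply: DeriveDef; [exact: dH|rewrite -derive1E].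
    by rewrite -[h x]add0r; exact: (is_deriveD (is_derive_cst (f a) x 1) dH').
  have [df f'] := near_eq_is_derive fH dfaH.
  by split; [exact: df|rewrite derive1E].
Unshelve. all: by end_near. Qed.

End ac_FTC.

(** * Elementary derivatives and integrals *)

Section derive_rules.
Context {R : realType}.
Implicit Types (f g : R -> R) (x c : R).

Lemma is_derive_continuous (F : R -> R) (t d : R) : is_derive t 1 F d ->
  {for t, continuous F}.
Proof.
by move=> [dF _]; apply: differentiable_continuous; apply/derivable1_diffP.
Qed.

(** [is_derive] stripped of its class status: while the rules below are applied
    the value of the derivative is an unknown, on which instance resolution
    must not act. *)
Definition has_derivative f x (d : R) : Prop := is_derive x 1 f d.

Lemma has_derivative_cst c x : has_derivative (fun=> c) x 0.
Proof. exact: is_derive_cst. Qed.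

Lemma has_derivative_id x : has_derivative (fun t : R => t) x 1.
Proof. exact: is_derive_id. Qed.

Lemma has_derivative_add f g x df dg :
  has_derivative f x df -> has_derivative g x dg ->
  has_derivative (fun t => f t + g t) x (df + dg).
Proof. by move=> hf hg; exact: is_deriveD. Qed.

Lemma has_derivative_opp f x df : has_derivative f x df ->
  has_derivative (fun t => - f t) x (- df).
Proof. by move=> hf; exact: is_deriveN. Qed.

Lemma has_derivative_mul f g x df dg :
  has_derivative f x df -> has_derivative g x dg ->
  has_derivative (fun t => f t * g t) x (f x * dg + g x * df).
Proof. by move=> hf hg; exact: is_deriveM. Qed.

Lemma has_derivative_expn n x :
  has_derivative (fun t : R => t ^+ n.+1) x (n.+1%:R * x ^+ n).
Proof.
have := @is_deriveX _ _ id n.+1 x (1 : R) 1 (is_derive_id x (1 : R)).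
by rewrite exprfctE /GRing.scale/= mulr1.
Qed.

Lemma has_derivative_inv x : x != 0 ->
  has_derivative (fun t : R => t^-1) x (- x ^- 2).
Proof.
move=> x0; have := is_deriveV x0 (is_derive_id x (1 : R)).
by rewrite /GRing.scale/= mulr1.
Qed.

Lemma has_derivative_ln x : 0 < x -> has_derivative (@ln R) x x^-1.
Proof. exact: is_derive1_ln. Qed.

Lemma has_derivative_eq f x d d' : has_derivative f x d -> d = d' ->
  is_derive x 1 f d'.
Proof. by move=> ? <-. Qed.

Lemma has_derivative_continuous f x d : has_derivative f x d ->
  {for x, continuous f}.
Proof. exact: is_derive_continuous. Qed.

End derive_rules.

Ltac derivative :=
  repeat first [ apply: has_derivative_cst | apply: has_derivative_id
    | apply: has_derivative_expn | apply: has_derivative_inv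
    | apply: has_derivative_ln | apply: has_derivative_add
    | apply: has_derivative_opp | apply: has_derivative_mul ].

Section FTC2.
Context {R : realType}.
Local Notation mu := (@lebesgue_measure R).

Lemma continuous_itv_integrable (f : R -> R) (x y : R) :
  (forall t, x <= t <= y -> {for t, continuous f}) ->
  mu.-integrable `[x, y] (EFin \o f).
Proof.
move=> cf; apply: continuous_compact_integrable; first exact: segment_compact.
apply: continuous_in_subspaceT => t; rewrite inE/= in_itv/=; exact: cf.
Qed.

Lemma integral_itv_derive (F f : R -> R) (x y : R) : x <= y ->
  (forall t, x <= t <= y -> is_derive t 1 F (f t)) ->
  (forall t, x <= t <= y -> {for t, continuous f}) ->
  (\int[mu]_(t in `[x, y]) (f t)%:E = (F y - F x)%:E)%E.
Proof.
rewrite le_eqVlt => /predU1P[<- _ _|xy dF cf].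
  by rewrite set_itv1 integral_set1 subrr.
rewrite (@continuous_FTC2 _ f F)//.
- apply: continuous_in_subspaceT => t; rewrite inE/= in_itv/=; exact: cf.
- split.
  + move=> t; rewrite in_itv/= => /andP[/ltW xt /ltW ty].
    by have [] := dF t; rewrite ?xt.
  + apply: cvg_at_right_filter; apply: is_derive_continuous; apply: dF.
    by rewrite lexx ltW.
  + apply: cvg_at_left_filter; apply: is_derive_continuous; apply: dF.
    by rewrite lexx ltW.
- move=> t; rewrite in_itv/= => /andP[/ltW xt /ltW ty].
  by rewrite derive1E; apply: derive_val; apply: dF; rewrite xt.
Qed.

Lemma ae_neq (c : R) : \forall x \ae mu, x != c.
Proof.
exists [set c]; split; [exact: measurable_set1|exact: lebesgue_measure_set1|].
by move=> x /= /negP; rewrite negbK => /eqP.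
Qed.

End FTC2.

Section integral_linear.
Context {R : realType}.
Local Notation mu := (@lebesgue_measure R).
Implicit Types (u v : R -> R).

Lemma Rintegral_combine4 (a b : R) (u1 u2 u3 u4 : R -> R) (c1 c2 c3 c4 : R) :
  continuous u1 -> continuous u2 -> continuous u3 -> continuous u4 ->
  \int[mu]_(t in `[a, b]) (c1 * u1 t + c2 * u2 t + c3 * u3 t + c4 * u4 t) =
  c1 * (\int[mu]_(t in `[a, b]) u1 t) + c2 * (\int[mu]_(t in `[a, b]) u2 t) +
  c3 * (\int[mu]_(t in `[a, b]) u3 t) + c4 * (\int[mu]_(t in `[a, b]) u4 t).
Proof.
move=> k1 k2 k3 k4.
have cM (c : R) u : continuous u -> continuous (fun t => c * u t).
  by move=> cu t; rewrite /continuous_at; apply: cvgM; [exact: cvg_cst|exact: cu].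
have cD u v : continuous u -> continuous v -> continuous (fun t => u t + v t).
  by move=> cu cv t; rewrite /continuous_at; apply: cvgD; [exact: cu|exact: cv].
have ci u : continuous u -> mu.-integrable `[a, b] (EFin \o u).
  by move=> cu; apply: continuous_itv_integrable => t _; exact: cu.
have := (ci _ (cM c1 _ k1), ci _ (cM c2 _ k2), ci _ (cM c3 _ k3), ci _ (cM c4 _ k4)).
have := ci _ (cD _ _ (cM c1 _ k1) (cM c2 _ k2)).
have := ci _ (cD _ _ (cD _ _ (cM c1 _ k1) (cM c2 _ k2)) (cM c3 _ k3)).
move: (ci _ k1) (ci _ k2) (ci _ k3) (ci _ k4) => i1 i2 i3 i4 i123 i12 [[[j1 j2] j3] j4].
by rewrite !RintegralD ?RintegralZl.
Qed.

End integral_linear.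

(** * The quotient of a function by the identity *)

Section quotient.
Context {R : realType}.

(** This is [- t ^ 2] times the derivative of [f t / t]. *)
Definition defect (f : R -> R) (t : R) := f t - t * f^`()%classic t.

Local Notation mu := (@lebesgue_measure R).
Variables (a b : R) (f : R -> R).
Hypotheses (a0 : 0 < a) (ab : a < b) (acf : ac_seq a b f).

Lemma ac_seq_bounded : exists2 C : R, 0 <= C & forall x, a <= x <= b -> `|f x| <= C.
Proof.
have bv := ac_seq_bounded_variation (ltW ab) acf.
exists (`|f a| + variation_to a f b).
  by rewrite addr_ge0// /variation_to fine_ge0// total_variation_ge0 ?ltW.
move=> x /andP[ax xb].
have h1 := total_variation_ge f ax.
rewrite -(variation_toB bv)// lee_fin in h1.
have h2 : variation_to a f x <= variation_to a f b.
  by apply: (variation_to_nondecreasing bv) => //; rewrite in_itv/= ?ax ?xb ?lexx ?(ltW ab).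
have h3 : 0 <= variation_to a f a by rewrite /variation_to total_variationxx.
have -> : f x = f a + (f x - f a) by ring.
apply: le_trans (ler_normD _ _) _; lra.
Qed.

(** Division by a function bounded away from 0 and Lipschitz; a bound [C] of
    [f] enters through the increment of [1 / t]. *)
Lemma ac_seq_div_id : ac_seq a b (fun t => f t / t).
Proof.
have [C C0 fC] := ac_seq_bounded.
move=> e e0; have ea : 0 < e * a / 2 by rewrite divr_gt0// mulr_gt0.
have [d d0 fd] := acf ea.
pose d' := e * a ^+ 2 / 2 / (C + 1).
have d'0 : 0 < d' by rewrite !divr_gt0// ?mulr_gt0// ?exprn_gt0//; lra.
exists (Num.min d d'); first by rewrite lt_min d0.
move=> l lab; rewrite lt_min => /andP[/(fd _ lab) h1 h2].
have h3 : \sum_(p <- l) `|f p.2 / p.2 - f p.1 / p.1| <=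
   a^-1 * (\sum_(p <- l) `|f p.2 - f p.1|) + C / a ^+ 2 * total_length l.
  rewrite !mulr_sumr -big_split/= big_seq [leRHS]big_seq; apply: ler_sum => -[s t] pl /=.
  have /andP[/allP/(_ _ pl)/and3P[/= as_ st tb] _] := lab.
  have s0 : 0 < s by exact: lt_le_trans as_.
  have t0 : 0 < t by exact: lt_trans st.
  have -> : f t / t - f s / s = (f t - f s) / t - f s * (t - s) / (s * t).
    by field; rewrite !gt_eqF.
  apply: le_trans (ler_normB _ _) _; apply: lerD.
    rewrite normrM mulrC ler_wpM2r// gtr0_norm ?invr_gt0// lef_pV2 ?posrE//.
    by rewrite (le_trans as_)// ltW.
  rewrite !normrM (gtr0_norm (_ : 0 < t - s)) ?subr_gt0//.
  have st0 : 0 < (s * t)^-1 by rewrite invr_gt0 mulr_gt0.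
  rewrite (gtr0_norm st0) mulrAC ler_wpM2r ?subr_ge0 ?(ltW st)// ler_pM//.
  - exact: ltW.
  - by apply: fC; rewrite as_ (le_trans (ltW st)).
  - rewrite lef_pV2 ?posrE ?mulr_gt0 ?exprn_gt0// expr2 ler_pM//; try exact: ltW.
    by rewrite (le_trans as_)// ltW.
apply: le_lt_trans h3 _.
have -> : e = a^-1 * (e * a / 2) + (C + 1) / a ^+ 2 * d'.
  have aN0 : a != 0 by rewrite gt_eqF.
  have CN0 : C + 1 != 0 by rewrite gt_eqF//; lra.
  by rewrite /d'; field; rewrite CN0 aN0.
apply: ltr_leD; first by rewrite ltr_pM2l// invr_gt0.
apply: ler_pM; rewrite ?divr_ge0 ?exprn_ge0 ?(ltW a0)//.
- rewrite /total_length big_seq sumr_ge0// => p pl.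
  by have /andP[/allP/(_ _ pl)/and3P[_ /ltW]] := lab; rewrite subr_ge0.
- by rewrite ler_wpM2r ?invr_ge0 ?exprn_ge0 ?(ltW a0)//; lra.
- exact: ltW.
Qed.

(** Wherever [f t / t] is differentiable so is [f], being its product by [t], and
    the product rule then expresses the density by [f] and its derivative. *)
Lemma quotient_density : exists h : R -> R, [/\ mu.-integrable setT (EFin \o h),
    forall x y, a <= x -> x <= y -> y <= b ->
      f y / y - f x / x = \int[mu]_(t in `[x, y]) h t &
    \forall x \ae mu, a <= x <= b -> h x = - (defect f x / x ^+ 2)].
Proof.
have [h [ih hE hD]] := ac_seq_FTC ab ac_seq_div_id.
exists h; split => //.
have := ae_filter_ringOfSetsType mu => ?.
near=> x => /andP[ax xb].
have xa : x != a by near: x; exact: ae_neq.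
have xb' : x != b by near: x; exact: ae_neq.
have {}ax : a < x by rewrite lt_neqAle eq_sym xa.
have {}xb : x < b by rewrite lt_neqAle xb'.
have x0 : 0 < x := lt_trans a0 ax.
have [dF F'] : derivable (fun t => f t / t) x 1 /\
    (fun t => f t / t)^`()%classic x = h x.
  by have : a < x < b; [rewrite ax|near: x].
have xN0 : x != 0 by rewrite gt_eqF.
have Ff : {near x, (fun t => t * (f t / t)) =1 f}.
  near=> t; have t0 : t != 0 by rewrite gt_eqF//; near: t; exact: lt_nbhsr.
  by rewrite mulrCA divff// mulr1.
have dP : is_derive x 1 (fun t => t * (f t / t)) (f x / x + x * h x).
  have dF' : is_derive x 1 (fun t => f t / t) (h x).
    by apply: DeriveDef => //; rewrite -derive1E.
  rewrite (_ : _ + _ = x *: h x + (f x / x)%:A).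
    exact: (is_deriveM (is_derive_id x (1 : R)) dF').
  by rewrite /GRing.scale/= mulr1 addrC.
have [_ f'] := near_eq_is_derive Ff dP.
by rewrite /defect derive1E f'; field.
Unshelve. all: by end_near. Qed.

End quotient.

Section cross_difference.
Context {R : realType}.
Local Notation mu := (@lebesgue_measure R).
Variables (a b : R) (f : R -> R).
Hypotheses (a0 : 0 < a) (ab : a < b) (acf : ac_seq a b f).

Lemma quotient_increment_le (phi : R -> R) x y : a <= x -> x <= y -> y <= b ->
  measurable_fun `[x, y] phi -> (forall t, 0 <= phi t) ->
  (\forall t \ae mu, x <= t <= y -> `|defect f t| / t ^+ 2 <= phi t) ->
  (`|f y / y - f x / x|%:E <= \int[mu]_(t in `[x, y]) (phi t)%:E)%E.
Proof.
move=> ax xy yb mphi phi0 phiP.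
have [h [ih hE hD]] := quotient_density a0 ab acf.
have ihxy : mu.-integrable `[x, y] (EFin \o h) by exact: integrableS ih.
have mh : measurable_fun `[x, y] (EFin \o h) by case/integrableP : ihxy.
rewrite hE// EFin_normr_Rintegral//.
apply: le_trans (le_abse_integral _ _ _) _ => //.
apply: ae_ge0_le_integral => //.
- exact: measurableT_comp.
- by move=> t _; rewrite lee_fin.
- exact/measurable_EFinP.
have := ae_filter_ringOfSetsType mu => ?.
near=> t; rewrite /= in_itv/= => /andP[xt ty].
have tP : `|defect f t| / t ^+ 2 <= phi t.
  by have : x <= t <= y; [rewrite xt|near: t].
have tab : a <= t <= b by rewrite (le_trans ax xt) (le_trans ty yb).
have -> : h t = - (defect f t / t ^+ 2) by move: tab; near: t.
rewrite lee_fin normrN normrM (ger0_norm (_ : 0 <= (t ^+ 2)^-1))//.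
by rewrite invr_ge0 sqr_ge0.
Unshelve. all: by end_near. Qed.

Lemma cross_difference_quotient x y : 0 < x -> 0 < y ->
  `|x * f y - y * f x| = x * y * `|f y / y - f x / x|.
Proof.
move=> x0 y0; rewrite -[x * y]gtr0_norm ?mulr_gt0// -normrM; congr `|_|.
by field; rewrite !gt_eqF.
Qed.

(** Integrating [M / t ^ 2] bounds the increment of [f t / t] by
    [M (1 / x - 1 / y)]; the factor [x y] turns this into [M (y - x)]. *)
Lemma cross_difference_sup_le (M : R) : 0 <= M ->
  (\forall t \ae mu, a <= t <= b -> `|defect f t| <= M) ->
  forall x y, a <= x -> x <= y -> y <= b -> `|x * f y - y * f x| <= M * (y - x).
Proof.
move=> M0 MP x y ax xy yb.
have x0 : 0 < x := lt_le_trans a0 ax.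
have y0 : 0 < y := lt_le_trans x0 xy.
have dt t : x <= t <= y -> is_derive t 1 (fun t => - M / t) (M / t ^+ 2).
  move=> /andP[xt _]; have t0 : t != 0 by rewrite gt_eqF// (lt_le_trans x0).
  by apply: has_derivative_eq; [derivative|rewrite /=; field].
have ct t : x <= t <= y -> {for t, continuous (fun t : R => M / t ^+ 2 : R)}.
  move=> /andP[xt _]; have t0 : t != 0 by rewrite gt_eqF// (lt_le_trans x0).
  rewrite /continuous_at; apply: cvgM; first exact: cvg_cst.
  by apply: cvgV; [rewrite expf_neq0|exact: exprn_continuous].
have := @quotient_increment_le (fun t => M / t ^+ 2) x y ax xy yb.
rewrite (integral_itv_derive xy dt ct) lee_fin => h.
rewrite cross_difference_quotient//.
have -> : M * (y - x) = x * y * (- M / y - - M / x).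
  by field; rewrite !gt_eqF.
rewrite ler_wpM2l ?(mulr_ge0 (ltW x0) (ltW y0))//; apply: h => [|t|].
- by have /integrableP[/measurable_EFinP] := continuous_itv_integrable ct.
- by rewrite divr_ge0 ?sqr_ge0.
have := ae_filter_ringOfSetsType mu => ?.
apply: filterS MP => t H /andP[xt ty].
by rewrite ler_wpM2r ?invr_ge0 ?sqr_ge0// H// (le_trans ax xt) (le_trans ty yb).
Qed.

(** Here [1 / t ^ 2] is bounded by its value at the left end, and [x y / x ^ 2]
    is the ratio in the conclusion. *)
Lemma cross_difference_L1_le (N : R) :
  measurable_fun setT (defect f \_ `[a, b]) ->
  (\int[mu]_t `|(defect f \_ `[a, b]) t|%:E <= N%:E)%E ->
  forall x y, a <= x -> x <= y -> y <= b -> `|x * f y - y * f x| <= N * (y / x).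
Proof.
move=> mk NP x y ax xy yb.
have x0 : 0 < x := lt_le_trans a0 ax.
have y0 : 0 < y := lt_le_trans x0 xy.
pose k := defect f \_ `[a, b].
have := @quotient_increment_le (fun t => x ^- 2 * `|k t|) x y ax xy yb.
have mk' : measurable_fun setT (fun t => `|k t|) by exact: measurableT_comp.
have xV0 : 0 <= x ^- 2 by rewrite invr_ge0 sqr_ge0.
move=> h; have {}h : (`|f y / y - f x / x|%:E <= (x ^- 2 * N)%:E)%E.
  apply: le_trans (h _ _ _) _.
  - by apply: measurable_funM => //; exact: measurable_funTS.
  - by move=> t; rewrite mulr_ge0.
  - apply: nearW => t /andP[xt ty].
    have t0 : 0 < t := lt_le_trans x0 xt.
    rewrite /k patchE mem_set/=; last first.
      by rewrite in_itv/= (le_trans ax xt) (le_trans ty yb).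
    rewrite mulrC ler_wpM2r// lef_pV2 ?posrE ?exprn_gt0//.
    by rewrite ler_pXn2r ?nnegrE ?(ltW x0) ?(ltW t0).
  under eq_integral do rewrite EFinM.
  rewrite ge0_integralZl//; last first.
    by apply/measurable_EFinP; exact: measurable_funTS.
  rewrite EFinM lee_pmul2l//; last by rewrite lte_fin invr_gt0 exprn_gt0.
  apply: le_trans NP; apply: ge0_subset_integral => //.
  exact/measurable_EFinP.
rewrite lee_fin in h; rewrite cross_difference_quotient//.
have -> : N * (y / x) = x * y * (x ^- 2 * N) by field; rewrite gt_eqF.
by rewrite ler_wpM2l ?(mulr_ge0 (ltW x0) (ltW y0)).
Qed.

End cross_difference.

(** * The double integral *)

Section double_integral.
Context {R : realType}.
Local Notation mu := (@lebesgue_measure R).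
Variables (a b : R).
Hypotheses (a0 : 0 < a) (ab : a < b).

Let pos_itv t : a <= t <= b -> 0 < t.
Proof. by move=> /andP[at_ _]; exact: lt_le_trans at_. Qed.

Lemma Rintegral_sqr : \int[mu]_(t in `[a, b]) (t ^+ 2) = (b ^+ 3 - a ^+ 3) / 3.
Proof.
rewrite /Rintegral -[RHS]/(fine ((b ^+ 3 - a ^+ 3) / 3)%:E) mulrBl; congr fine.
apply: (integral_itv_derive (F := fun t => t ^+ 3 / 3)); first exact: ltW.
- by move=> t _; apply: has_derivative_eq; [derivative|rewrite /=; field].
- by move=> t _; exact: exprn_continuous.
Qed.

(** For [x] in [[a, b]], the integral over [y] in [[a, b]] of the weight
    [|x - y| max(x, y) / min(x, y)]: the first three terms come from [[a, x]],
    the others from [[x, b]]. *)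
Definition weight_integral (x : R) : R := x ^+ 2 * (ln x - ln a) - x ^+ 2 + a * x
  + b ^+ 3 / 3 * x^-1 - b ^+ 2 / 2 + x ^+ 2 / 6.

Lemma integral_weight_left (c x : R) : a <= x <= b ->
  (\int[mu]_(t in `[a, x]) (c * ((x - t) * (x / t)))%:E =
   (c * (x ^+ 2 * (ln x - ln a) - x ^+ 2 + a * x))%:E)%E.
Proof.
move=> axb; have /andP[ax xb] := axb.
pose F t := c * (x ^+ 2 * ln t - x * t).
transitivity (F x - F a)%:E; last by congr EFin; rewrite /F; ring.
apply: integral_itv_derive; first exact: ax.
- move=> t /andP[at_ tx].
  have t0 : 0 < t by apply: pos_itv; rewrite at_ (le_trans tx xb).
  have tN0 : t != 0 by rewrite gt_eqF.
  by apply: has_derivative_eq; [derivative|rewrite /=; field].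
- move=> t /andP[at_ tx].
  have t0 : 0 < t by apply: pos_itv; rewrite at_ (le_trans tx xb).
  have tN0 : t != 0 by rewrite gt_eqF.
  by apply: has_derivative_continuous; derivative.
Qed.

Lemma integral_weight_right (c x : R) : a <= x <= b ->
  (\int[mu]_(t in `[x, b]) (c * ((t - x) * (t / x)))%:E =
   (c * (b ^+ 3 / 3 * x^-1 - b ^+ 2 / 2 + x ^+ 2 / 6))%:E)%E.
Proof.
move=> axb; have /andP[ax xb] := axb.
have xN0 : x != 0 by rewrite gt_eqF// pos_itv.
pose F t := c * (t ^+ 3 / 3 * x^-1 - t ^+ 2 / 2).
transitivity (F b - F x)%:E; last by congr EFin; rewrite /F; field.
apply: integral_itv_derive; first exact: xb.
- by move=> t _; apply: has_derivative_eq; [derivative|rewrite /=; field].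
- by move=> t _; apply: has_derivative_continuous; derivative.
Qed.

Lemma integral_weight_integral (c : R) :
  (\int[mu]_(x in `[a, b]) (c * weight_integral x)%:E =
   (c * (b ^+ 2 * a - (a ^+ 3 + 8 * b ^+ 3) / 9
            + 2 / 3 * b ^+ 3 * ln (b / a)))%:E)%E.
Proof.
have b0 : 0 < b by exact: lt_trans ab.
(* 7 / 18 = 1 / 9 + 1 / 3 - 1 / 18 gathers the three cubic terms *)
pose F x := c * (x ^+ 3 / 3 * (ln x - ln a) - x ^+ 3 * (7 / 18) + a * (x ^+ 2 / 2)
  + b ^+ 3 / 3 * ln x - b ^+ 2 / 2 * x).
transitivity (F b - F a)%:E; last by congr EFin; rewrite /F ln_div ?posrE//; field.
apply: integral_itv_derive; first exact: ltW.
- move=> x axb; have x0 := pos_itv axb.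
  have xN0 : x != 0 by rewrite gt_eqF.
  by apply: has_derivative_eq; [derivative|rewrite /weight_integral/=; field].
- move=> x axb; have x0 := pos_itv axb.
  have xN0 : x != 0 by rewrite gt_eqF.
  by apply: has_derivative_continuous; rewrite /weight_integral; derivative.
Qed.

Variables (f g : R -> R) (M N : R).
Hypotheses (cf : continuous f) (cg : continuous g) (M0 : 0 <= M) (N0 : 0 <= N).
Hypothesis fM : forall x y, a <= x -> x <= y -> y <= b ->
  `|x * f y - y * f x| <= M * (y - x).
Hypothesis gN : forall x y, a <= x -> x <= y -> y <= b ->
  `|x * g y - y * g x| <= N * (y / x).

Local Notation I h := (\int[mu]_(t in `[a, b]) h t).

Let cM2 (u v : R -> R) : continuous u -> continuous v -> continuous (fun t => u t * v t).
Proof. by move=> cu cv t; rewrite /continuous_at; apply: cvgM; [exact: cu|exact: cv]. Qed.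

Let cid : continuous (fun t : R => t). Proof. by move=> t; exact: cvg_id. Qed.

Let csq : continuous (fun t : R => t ^+ 2).
Proof. exact: exprn_continuous. Qed.

Let inner (x : R) : R :=
  \int[mu]_(y in `[a, b]) ((x * f y - y * f x) * (x * g y - y * g x)).

(** The inner integral is linear in four fixed integrals, so Korkine's identity
    below follows by integrating twice in one variable, without Fubini. *)
Let innerE x : inner x = I (fun t => f t * g t) * x ^+ 2
  + - I (fun t => t * f t) * (x * g x) + - I (fun t => t * g t) * (x * f x)
  + (b ^+ 3 - a ^+ 3) / 3 * (f x * g x).
Proof.
rewrite -Rintegral_sqr /inner.
transitivity (\int[mu]_(y in `[a, b]) (x ^+ 2 * (f y * g y) + - (x * g x) * (y * f y)
  + - (x * f x) * (y * g y) + f x * g x * (y ^+ 2))).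
  by apply: eq_Rintegral => y _; ring.
rewrite Rintegral_combine4//; [ring|exact: cM2..].
Qed.

Let Rintegral_inner : I inner = 2 * pompeiu_chebyshev a b f g.
Proof.
transitivity (\int[mu]_(x in `[a, b]) (I (fun t => f t * g t) * x ^+ 2
  + - I (fun t => t * f t) * (x * g x) + - I (fun t => t * g t) * (x * f x)
  + (b ^+ 3 - a ^+ 3) / 3 * (f x * g x))).
  by apply: eq_Rintegral => x _; exact: innerE.
rewrite Rintegral_combine4//; [|exact: cM2..].
rewrite Rintegral_sqr /pompeiu_chebyshev; ring.
Qed.

Let inner_le x : a <= x <= b ->
  `|inner x| <= M * N * weight_integral x.
Proof.
move=> axb; have /andP[ax xb] := axb.
pose psi y := (x * f y - y * f x) * (x * g y - y * g x).
have ccst (c : R) : continuous (fun _ : R => c) by move=> t; exact: cvg_cst.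
have cpsi : continuous psi.
  by apply: cM2 => t; rewrite /continuous_at; apply: cvgB;
    [apply: cM2|apply: cM2|apply: cM2|apply: cM2].
have ipsi (u v : R) : mu.-integrable `[u, v] (EFin \o psi).
  by apply: continuous_itv_integrable => t _; exact: cpsi.
have mpsi (D : set R) : measurable_fun D (fun y => `|psi y|%:E).
  apply: (@measurable_funS _ _ _ _ setT) => //.
  apply/measurable_EFinP; apply: measurableT_comp => //.
  exact: continuous_measurable_fun.
have mweight (h : R -> R) (u v : R) : (forall t, u <= t <= v -> {for t, continuous h}) ->
    measurable_fun `[u, v] (fun t => (h t)%:E).
  by move=> ch; have /integrableP[] := continuous_itv_integrable ch.
rewrite -lee_fin /inner EFin_normr_Rintegral//.
apply: le_trans (le_abse_integral _ _ _) _ => //.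
  by have /integrableP[] := ipsi a b.
rewrite [X in (X <= _)%E](_ : _ = \int[mu]_(y in `[a, b]) `|psi y|%:E)%E//.
rewrite (@itv_bndbnd_setU _ _ (BLeft a) (BRight x))//=.
rewrite ge0_integral_setU//=; [|apply: mpsi|]; last first.
  apply/disj_setPLR => t /=; rewrite !in_itv/= => /andP[_ tx] /andP[xt _].
  by move: xt; rewrite ltNge tx.
rewrite integral_itv_obnd_cbnd; last exact: mpsi.
have -> : M * N * weight_integral x =
    M * N * (x ^+ 2 * (ln x - ln a) - x ^+ 2 + a * x) +
    M * N * (b ^+ 3 / 3 * x^-1 - b ^+ 2 / 2 + x ^+ 2 / 6).
  rewrite /weight_integral; ring.
have x0 := pos_itv axb.
have MN0 : 0 <= M * N by exact: mulr_ge0.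
rewrite EFinD -integral_weight_left// -integral_weight_right//.
apply: leeD; apply: ge0_le_integral => //.
- exact: mpsi.
- apply: mweight => t /andP[at_ tx].
  have t0 : t != 0 by rewrite gt_eqF// (lt_le_trans a0).
  by apply: has_derivative_continuous; derivative.
- move=> t /=; rewrite in_itv/= => /andP[at_ tx].
  rewrite lee_fin normrM mulrACA; apply: ler_pM => //.
    by rewrite distrC; exact: fM.
  by rewrite distrC; exact: gN.
- exact: mpsi.
- apply: mweight => t _.
  by apply: has_derivative_continuous; derivative.
- move=> t /=; rewrite in_itv/= => /andP[xt tb].
  by rewrite lee_fin normrM mulrACA; apply: ler_pM => //; [exact: fM|exact: gN].
Qed.

(** Continuity on the whole line makes every integrand integrable; it costs
    nothing, since only the values on [[a, b]] enter the functional. *)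
Lemma pompeiu_chebyshev_continuous_le : `|pompeiu_chebyshev a b f g| <=
  2^-1 * (b ^+ 2 * a - (a ^+ 3 + 8 * b ^+ 3) / 9 + 2 / 3 * b ^+ 3 * ln (b / a)) * M * N.
Proof.
have cinner : continuous inner.
  rewrite (_ : inner = fun x : R => I (fun t => f t * g t) * x ^+ 2
  + - I (fun t => t * f t) * (x * g x) + - I (fun t => t * g t) * (x * f x)
  + (b ^+ 3 - a ^+ 3) / 3 * (f x * g x)); last by apply/funext => x; exact: innerE.
  have ccst (c : R) : continuous (fun _ : R => c) by move=> t; exact: cvg_cst.
  have cadd (u v : R -> R) : continuous u -> continuous v ->
      continuous (fun t => u t + v t).
    by move=> cu cv t; rewrite /continuous_at; apply: cvgD; [exact: cu|exact: cv].
  exact: (cadd _ _ (cadd _ _ (cadd _ _ (cM2 (ccst _) csq) (cM2 (ccst _) (cM2 cid cg)))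
    (cM2 (ccst _) (cM2 cid cf))) (cM2 (ccst _) (cM2 cf cg))).
have iinner : mu.-integrable `[a, b] (EFin \o inner).
  by apply: continuous_itv_integrable => t _; exact: cinner.
have cweight t : a <= t <= b -> {for t, continuous (fun x => M * N * weight_integral x)}.
  move=> atb; have t0 : t != 0 by rewrite gt_eqF// pos_itv.
  apply: has_derivative_continuous; rewrite /weight_integral; derivative => //.
  exact: pos_itv.
have : `|2 * pompeiu_chebyshev a b f g| <= M * N * (b ^+ 2 * a - (a ^+ 3 + 8 * b ^+ 3) / 9
            + 2 / 3 * b ^+ 3 * ln (b / a)).
  rewrite -Rintegral_inner -lee_fin EFin_normr_Rintegral// -integral_weight_integral.
  have mi : measurable_fun `[a, b] (EFin \o inner) by case/integrableP : iinner.
  apply: le_trans (le_abse_integral _ _ _) _ => //.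
  apply: ge0_le_integral => //.
  - exact: measurableT_comp.
  - by have /integrableP[] := continuous_itv_integrable cweight.
rewrite normrM ger0_norm//; lra.
Qed.

End double_integral.

(** * Finiteness of the norms *)

Section defect_norms.
Context {R : realType}.
Local Notation mu := (@lebesgue_measure R).
Variables (a b : R).
Hypotheses (a0 : 0 < a) (ab : a < b).

Lemma lebesgue_measureT_gt0 : (0 < mu [set: R])%E.
Proof. by rewrite -set_itvNyy lebesgue_measure_itv/= ltry. Qed.

Lemma Lp_norm_ooE (k : R -> R) :
  Lp_norm a b +oo k = ess_sup mu (fun t => `|(k \_ `[a, b]) t|%:E).
Proof. by rewrite /Lp_norm unlock lebesgue_measureT_gt0. Qed.

Lemma Lp_norm_oo_ae (k : R -> R) :
  \forall t \ae mu, (`|(k \_ `[a, b]) t|%:E <= Lp_norm a b +oo k)%E.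
Proof. by rewrite Lp_norm_ooE; exact: ess_sup_ge. Qed.

(** Finiteness matters: with a norm equal to [+oo], a product with a vanishing
    norm would give a bound of 0. *)
Lemma defect_Lp_norm_oo_lty (f : R -> R) : ac_seq a b f ->
  in_Lp a b +oo f^`()%classic -> (Lp_norm a b +oo (defect f) < +oo)%E.
Proof.
move=> acf /sub_Lfun_finLfun; rewrite inE/= /finite_norm -/(Lp_norm a b +oo _) => f'oo.
have [C C0 fC] := ac_seq_bounded ab acf.
have f'fin : Lp_norm a b +oo f^`()%classic \is a fin_num.
  by rewrite ge0_fin_numE// /Lp_norm Lnorm_ge0.
pose D := fine (Lp_norm a b +oo f^`()%classic).
apply: (@le_lt_trans _ _ (C + b * D)%:E); last exact: ltry.
have b0 : 0 < b := lt_trans a0 ab.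
have D0 : 0 <= D by rewrite fine_ge0// /Lp_norm Lnorm_ge0.
rewrite Lp_norm_ooE; apply/ess_supP.
have := ae_filter_ringOfSetsType mu => ?.
apply: filterS (Lp_norm_oo_ae f^`()%classic) => t.
rewrite -(fineK f'fin) !lee_fin -/D !patchE; case: ifPn => [|_ _]; last first.
  by rewrite normr0 addr_ge0// mulr_ge0// ltW.
rewrite inE/= in_itv/= => /andP[at_ tb] f'D.
apply: le_trans (ler_normB _ _) _; apply: lerD; first by rewrite fC// at_.
rewrite normrM ler_pM// ger0_norm//.
by rewrite (le_trans _ at_)// ltW.
Qed.

Lemma restrict_defectE (f : R -> R) : defect f \_ `[a, b] =
  (f \o clamp a b) \_ `[a, b] \- (fun t => t * (f^`()%classic \_ `[a, b]) t).
Proof.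
apply/funext => t /=; rewrite !patchE; case: ifPn => [|_]; last by rewrite mulr0 subr0.
by rewrite inE/= in_itv/= => /andP[at_ tb]; rewrite /defect clamp_id.
Qed.

Lemma integrable_defect (f : R -> R) : ac_seq a b f ->
  in_Lp a b 1 f^`()%classic ->
  mu.-integrable setT (EFin \o (defect f \_ `[a, b])).
Proof.
move=> acf f'1; have b0 : 0 < b := lt_trans a0 ab.
have if' : mu.-integrable setT (EFin \o (f^`()%classic \_ `[a, b])).
  exact/Lfun1_integrable.
have cfc := ac_seq_clamp_continuous (ltW ab) acf.
have ifc : mu.-integrable setT (EFin \o ((f \o clamp a b) \_ `[a, b])).
  rewrite -restrict_EFin -integrable_mkcond//.
  by apply: continuous_itv_integrable => t _; exact: cfc.
have itf' : mu.-integrable setT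
    (EFin \o (fun t => t * (f^`()%classic \_ `[a, b]) t)).
  have iN := integrableZl measurableT b (integrable_abse if').
  apply: (le_integrable measurableT _ _ iN).
    have /integrableP[/measurable_EFinP mf' _] := if'.
    by apply/measurable_EFinP; apply: measurable_funM.
  move=> t _ /=; rewrite lee_fin !normrM normr_id (gtr0_norm b0).
  rewrite patchE; case: ifPn => [|_]; last by rewrite normr0 !mulr0.
  rewrite inE/= in_itv/= => /andP[at_ tb].
  rewrite ler_wpM2r// ger0_norm//.
  by rewrite (le_trans _ at_)// ltW.
rewrite restrict_defectE; set u := (_ \o _) \_ _ in ifc *.
set v := (fun t => _) in itf' *.
have -> : EFin \o (u \- v) = ((EFin \o u) \- (EFin \o v))%E by [].
exact: integrableB.
Qed.

End defect_norms.

(** * The Pompeiu-Chebyshev inequality *)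

Lemma pompeiu_chebyshev_clamp (R : realType) (a b : R) (f g : R -> R) :
  pompeiu_chebyshev a b (f \o clamp a b) (g \o clamp a b) = pompeiu_chebyshev a b f g.
Proof.
have clampE (t : R) : t \in `[a, b]%classic -> clamp a b t = t.
  by rewrite inE/= in_itv/= => /andP[at_ tb]; rewrite clamp_id.
rewrite /pompeiu_chebyshev; congr (_ * _ - _ * _);
  by apply: eq_Rintegral => t /clampE /= ->.
Qed.

Unset Implicit Arguments.

Theorem theorem10 (R : realType) (a b : R) (f g : R -> R)
  (a_gt0 : 0 < a) (ltab : a < b)
  (acf : abs_continuous a b f) (acg : abs_continuous a b g)
  (f'_Loo : in_Lp a b +oo%E f^`()%classic) (g'_L1 : in_Lp a b 1%E g^`()%classic) :
  (`|pompeiu_chebyshev a b f g|%:E <=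
   (2^-1 * (b ^+ 2 * a - (a ^+ 3 + 8 * b ^+ 3) / 9
            + 2 / 3 * b ^+ 3 * ln (b / a)))%:E
   * Lp_norm a b +oo (fun t : R => (f t - t * f^`()%classic t)%R)
   * Lp_norm a b 1 (fun t : R => (g t - t * g^`()%classic t)%R))%E.
Proof.
rewrite -[fun t => f t - _]/(defect f) -[fun t => g t - _]/(defect g).
move/abs_continuous_ac_seq in acf; move/abs_continuous_ac_seq in acg.
have Mfin : Lp_norm a b +oo (defect f) \is a fin_num.
  by rewrite ge0_fin_numE ?defect_Lp_norm_oo_lty// /Lp_norm Lnorm_ge0.
have NE : Lp_norm a b 1 (defect g) =
    (\int[lebesgue_measure]_t `|(defect g \_ `[a, b]) t|%:E)%E.
  by rewrite /Lp_norm Lnorm1.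
have /integrableP[mk Nlty] := integrable_defect a_gt0 ltab acg g'_L1.
have Nfin : Lp_norm a b 1 (defect g) \is a fin_num.
  by rewrite ge0_fin_numE /Lp_norm ?Lnorm_ge0// Lnorm1.
rewrite -(fineK Mfin) -(fineK Nfin) -!EFinM lee_fin -pompeiu_chebyshev_clamp.
have M0 : 0 <= fine (Lp_norm a b +oo (defect f)).
  by rewrite fine_ge0// /Lp_norm Lnorm_ge0.
apply: pompeiu_chebyshev_continuous_le.
- exact: a_gt0.
- exact: ltab.
- exact: ac_seq_clamp_continuous (ltW ltab) acf.
- exact: ac_seq_clamp_continuous (ltW ltab) acg.
- exact: M0.
- by rewrite fine_ge0// /Lp_norm Lnorm_ge0.
- move=> x y ax xy yb; rewrite /= !clamp_id ?(le_trans ax xy) ?(le_trans xy yb)//.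
  apply: (cross_difference_sup_le a_gt0 ltab acf) => //.
  have := ae_filter_ringOfSetsType (@lebesgue_measure R) => ?.
  apply: filterS (Lp_norm_oo_ae a b (defect f)) => t + tab.
  rewrite -{1}(fineK Mfin) lee_fin patchE mem_set//.
- move=> x y ax xy yb; rewrite /= !clamp_id ?(le_trans ax xy) ?(le_trans xy yb)//.
  apply: (cross_difference_L1_le a_gt0 ltab acg) => //; first exact/measurable_EFinP.
  by rewrite fineK// NE.
Qed.
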